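(* Let $T\colon V\to A$ be an $\mathcal O$-operator of a differential algebra $(A,\cdot,\Phi)$ associated to a bimodule $(V,l,r,\Omega)$. Then there exists a differential dendriform algebra structure $(V,\succ,\prec,\Omega)$ on $V$, where $\succ$ and $\prec$ are respectively defined by $$u\succ v:=l(T(u))v\quad\text{and}\quad u\prec v:=r(T(v))u,\qquad u,v\in V.$$
   Context: All vector spaces and algebras are finite-dimensional over a field $\mathbb F$ of characteristic $0$; ''algebra'' means associative algebra, not necessarily unital. Differential algebra $(A,\cdot,\Phi=\{\partial_k\}_{k=1}^m)$: $(A,\cdot)$ is an algebra and the $\partial_k$ are pairwise commuting derivations. A bimodule of $(A,\cdot,\Phi)$ is $(V,l,r,\Omega=\{\alpha_k\}_{k=1}^m)$ with $l,r\colon A\to\mathrm{End}(V)$ linear, $l(a)l(b)=l(a\cdot b)$, $r(b)r(a)=r(a\cdot b)$, $r(b)l(a)=l(a)r(b)$, and $\alpha_k$ pairwise commuting linear maps on $V$ with $\alpha_k(l(a)v)=l(\partial_k(a))v+l(a)\alpha_k(v)$, $\alpha_k(r(a)v)=r(\partial_k(a))v+r(a)\alpha_k(v)$. $T\colon V\to A$ linear is an $\mathcal O$-operator of $(A,\cdot,\Phi)$ associated to $(V,l,r,\Omega)$ if $T(u)\cdot T(v)=T(l(T(u))v+r(T(v))u)$ for all $u,v\in V$ and $\partial_kT=T\alpha_k$ for all $k$. Dendriform algebra $(A,\succ,\prec)$: a vector space with bilinear operations satisfying $(a\prec b)\prec c=a\prec(b\prec c+b\succ c)$, $(a\succ b)\prec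 c=a\succ(b\prec c)$, $(a\prec b+a\succ b)\succ c=a\succ(b\succ c)$. A derivation on it is a linear map $\partial$ with $\partial(a\succ b)=\partial(a)\succ b+a\succ\partial(b)$ and $\partial(a\prec b)=\partial(a)\prec b+a\prec\partial(b)$. A differential dendriform algebra is $(A,\succ,\prec,\Phi)$ with $\Phi$ a finite set of pairwise commuting derivations on the dendriform algebra $(A,\succ,\prec)$. *)

(* Defs.v *)
From mathcomp Require Import all_boot all_algebra.

Set Implicit Arguments.
Unset Strict Implicit.
Unset Printing Implicit Defensive.

Import GRing.Theory.
Local Open Scope ring_scope.

(* Algebras here need not be unital, so the product is an explicit operation on
   a [vectType] rather than a ring structure. A finite set of operators indexed
   by k = 1, ..., m is a family over ['I_m]; m = 0 is allowed. *)

Definition bilinear_op (F : fieldType) (A : vectType F) (op : A -> A -> A) :=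
  bilinear_for *:%R *:%R op.

Definition is_derivation (F : fieldType) (A : vectType F)
    (op : A -> A -> A) (d : 'End(A)) : Prop :=
  forall a b, d (op a b) = op (d a) b + op a (d b).

Definition pairwise_commuting (F : fieldType) (A : vectType F) (m : nat)
    (d : 'I_m -> 'End(A)) : Prop :=
  forall i j, (d i \o d j)%VF = (d j \o d i)%VF.

Record is_algebra (F : fieldType) (A : vectType F) (mul : A -> A -> A) : Prop :=
  IsAlgebra {
    alg_bilinear : bilinear_op mul;
    alg_assoc : associative mul }.

Record is_diff_algebra (F : fieldType) (A : vectType F) (mul : A -> A -> A)
    (m : nat) (Phi : 'I_m -> 'End(A)) : Prop :=
  IsDiffAlgebra {
    diff_algebra : is_algebra mul;
    diff_derivation : forall k, is_derivation mul (Phi k);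
    diff_commuting : pairwise_commuting Phi }.

Record is_diff_bimodule (F : fieldType) (A : vectType F) (mul : A -> A -> A)
    (m : nat) (Phi : 'I_m -> 'End(A)) (V : vectType F)
    (l r : 'Hom(A, 'End(V))) (Omega : 'I_m -> 'End(V)) : Prop :=
  IsDiffBimodule {
    bimod_l : forall a b, (l a \o l b)%VF = l (mul a b);
    bimod_r : forall a b, (r b \o r a)%VF = r (mul a b);
    bimod_rl : forall a b, (r b \o l a)%VF = (l a \o r b)%VF;
    bimod_commuting : pairwise_commuting Omega;
    bimod_diff_l : forall k a v,
      Omega k (l a v) = l (Phi k a) v + l a (Omega k v);
    bimod_diff_r : forall k a v,
      Omega k (r a v) = r (Phi k a) v + r a (Omega k v) }.

Record is_O_operator (F : fieldType) (A : vectType F) (mul : A -> A -> A)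
    (m : nat) (Phi : 'I_m -> 'End(A)) (V : vectType F)
    (l r : 'Hom(A, 'End(V))) (Omega : 'I_m -> 'End(V)) (T : 'Hom(V, A)) : Prop :=
  IsOOperator {
    O_mul : forall u v, mul (T u) (T v) = T (l (T u) v + r (T v) u);
    O_diff : forall k, (Phi k \o T)%VF = (T \o Omega k)%VF }.

Record is_dendriform (F : fieldType) (A : vectType F)
    (succ prec : A -> A -> A) : Prop :=
  IsDendriform {
    dend_succ_bilinear : bilinear_op succ;
    dend_prec_bilinear : bilinear_op prec;
    dend_prec_prec : forall a b c,
      prec (prec a b) c = prec a (prec b c + succ b c);
    dend_succ_prec : forall a b c,
      prec (succ a b) c = succ a (prec b c);
    dend_succ_succ : forall a b c,
      succ (prec a b + succ a b) c = succ a (succ b c) }.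

Record is_diff_dendriform (F : fieldType) (A : vectType F)
    (succ prec : A -> A -> A) (m : nat) (Phi : 'I_m -> 'End(A)) : Prop :=
  IsDiffDendriform {
    ddend_dendriform : is_dendriform succ prec;
    ddend_succ_derivation : forall k, is_derivation succ (Phi k);
    ddend_prec_derivation : forall k, is_derivation prec (Phi k);
    ddend_commuting : pairwise_commuting Phi }.

(* Main.v *)
Require Import Defs.
From mathcomp Require Import all_boot all_algebra.

Set Implicit Arguments.
Unset Strict Implicit.
Unset Printing Implicit Defensive.

Import GRing.Theory.
Local Open Scope ring_scope.

(** The [O]-operator identity says that [T] turns the sum of the two new
    operations into the product of [A]:
    [T u * T v = T (u succ v + u prec v)].  Hence the three dendriform axioms
    are the three bimodule axioms [l a l b = l (a * b)], [r b r a = r (a * b)]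
    and [r b l a = l a r b] read at points of the image of [T]; each side where
    the sum of the operations occurs is the side carrying [mul (T u) (T v)].
    Likewise [Phi k T = T Omega k] turns the Leibniz rules of the bimodule,
    where [Phi k] acts on [T u], into Leibniz rules where [Omega k] acts on
    [u].  The commutation of the [Omega k] is part of the bimodule. *)

(** Both operations have this shape, [prec] with its arguments exchanged. *)
Lemma bilinear_hom_action (F : fieldType) (A V : vectType F)
    (h : 'Hom(A, 'End(V))) (T : 'Hom(V, A)) :
  bilinear_op (fun u v : V => h (T u) v).
Proof.
split=> [v a u w | u a v w] /=; last by rewrite linearP.
by rewrite !linearP add_lfunE scale_lfunE.
Qed.

Lemma bilinear_op_flip (F : fieldType) (A : vectType F) (op : A -> A -> A) :
  bilinear_op op -> bilinear_op (fun u v => op v u).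
Proof. by case. Qed.

Theorem proposition4p26 (F : fieldType) (charF0 : [pchar F] =i pred0)
    (A : vectType F) (mul : A -> A -> A) (m : nat) (Phi : 'I_m -> 'End(A))
    (hA : is_diff_algebra mul Phi)
    (V : vectType F) (l r : 'Hom(A, 'End(V))) (Omega : 'I_m -> 'End(V))
    (hV : is_diff_bimodule mul Phi l r Omega)
    (T : 'Hom(V, A)) (hT : is_O_operator mul Phi l r Omega T) :
  is_diff_dendriform (fun u v : V => l (T u) v) (fun u v : V => r (T v) u) Omega.
Proof.
case: hV => lM rM rl commO OmegaL OmegaR; case: hT => TM PhiT.
have PhiTE k u : Phi k (T u) = T (Omega k u).
  by rewrite -!comp_lfunE PhiT.
split=> // [|k u v|k u v].
- split=> [||a b c|a b c|a b c].
  + exact: bilinear_hom_action.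
  + exact/bilinear_op_flip/bilinear_hom_action.
  + by rewrite addrC -TM -rM comp_lfunE.
  + by rewrite -(comp_lfunE (r _)) rl comp_lfunE.
  + by rewrite addrC -TM -lM comp_lfunE.
- by rewrite OmegaL PhiTE.
- by rewrite OmegaR PhiTE addrC.
Qed.
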